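(* Let $L,N,M\ge 1$ be integers, let $i,l\in\{1,\dots,L\}$ and $j,k\in\{1,\dots,N\}$, and let $\hat\theta_{ij},\hat\theta_{lk}\in\mathbb{R}$, $\hat\alpha_{ijl},\hat\alpha_{lkl}>0$ and $K_{ijl},K_{lkl}>0$. Let $\delta_{ij}^{lk}$ be the line-of-sight (LOS) interference between user $\mathrm{U}_{ij}$ and user $\mathrm{U}_{lk}$ based on their estimated locations, as defined in the context, and put $\hat\theta_{ij}^{lk}=\pi\left[\sin(\hat\theta_{ij})-\sin(\hat\theta_{lk})\right]$. Then $$\delta_{ij}^{lk}=\frac{\hat\alpha_{ijl}\,K_{ijl}\,(1+K_{lkl})}{\hat\alpha_{lkl}\,K_{lkl}\,(1+K_{ijl})}\cdot\frac{\left|\Theta(M,\hat\theta_{ij}^{lk})\right|^2}{M^2},$$ where $$\left|\Theta(M,\hat\theta_{ij}^{lk})\right|^2=\begin{cases}M^2, & \hat\theta_{ij}^{lk}=0,\\[4pt] \dfrac{\sin^2\left(M\hat\theta_{ij}^{lk}/2\right)}{\sin^2\left(\hat\theta_{ij}^{lk}/2\right)}, & -2\pi<\hat\theta_{ij}^{lk}<2\pi\ \text{and}\ \hat\theta_{ij}^{lk}\neq 0.\end{cases}$$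
   Context: Setting: a network of $L$ cells. The base station $\mathrm{BS}_l$ of cell $l$ has a uniform linear array of $M$ antennas with spacing equal to half the wavelength, and each cell has $N$ single-antenna users. $\mathrm{U}_{ij}$ denotes the $j$-th user of the $i$-th cell. $\hat\theta_{ij}$ is the estimated angle of arrival of $\mathrm{U}_{ij}$; in this model the LOS vector of $\mathrm{U}_{ij}$ at any base station is computed from the same angle $\hat\theta_{ij}$. $\hat\alpha_{ijl}>0$ is the estimated large-scale propagation coefficient between $\mathrm{U}_{ij}$ and $\mathrm{BS}_l$, and $K_{ijl}$ is the Rician $K$-factor of $\mathrm{U}_{ij}$ at $\mathrm{BS}_l$. Estimated LOS channel: with $\mathrm{j}$ the imaginary unit, $$\hat{\bar{\mathbf h}}_{ijl}=\left[1,\ e^{-\mathrm{j}\pi\sin(\hat\theta_{ij})},\ \dots,\ e^{-\mathrm{j}(M-1)\pi\sin(\hat\theta_{ij})}\right]^T\in\mathbb{C}^M,\qquad \hat{\bar{\mathbf g}}_{ijl}=\sqrt{\hat\alpha_{ijl}}\sqrt{\frac{K_{ijl}}{1+K_{ijl}}}\;\hat{\bar{\mathbf h}}_{ijl}.$$ LOS interference between $\mathrm{U}_{ij}$ and $\mathrm{U}_{lk}$ (at $\mathrm{BS}_l$), with $(\cdot)^H$ the conjugate transpose: $$\delta_{ij}^{lk}=\left|\frac{\hat{\bar{\mathbf g}}_{lkl}^H\,\hat{\bar{\mathbf g}}_{ijl}}{\hat{\bar{\mathbf g}}_{lkl}^H\,\hat{\bar{\mathbf g}}_{lkl}}\right|^2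 .$$ *)

(* Defs.v *)
From mathcomp Require Import all_boot all_order all_algebra.
From mathcomp Require Import complex.
From mathcomp Require Import all_classical all_reals all_analysis.

Set Implicit Arguments.
Unset Strict Implicit.
Unset Printing Implicit Defensive.

Import Order.TTheory GRing.Theory Num.Theory.

Local Open Scope ring_scope.
Local Open Scope complex_scope.
Local Open Scope sesquilinear_scope.

(* Complex modulus with values in R: on R[i] the library norm `|z| has values
   in R[i], and is equal to (cabs z)%:C. *)
Notation cabs := ComplexField.Normc.normc.

(* e ^ (j x) *)
Definition expj (R : realType) (x : R) : R[i] := cos x +i* sin x.

(* A network of L cells with N users each, and M antennas per base station:
     theta i j   : estimated angle of arrival of user (i, j),
     alpha i j l : large-scale coefficient between user (i, j) and BS l,
     K i j l     : Rician K-factor of user (i, j) at BS l. *)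

(* The angle of arrival of a user is the same at all base stations, so that the
   LOS vector of user (i, j) does not depend on the base station. *)
Definition los_h (R : realType) (L N M : nat) (theta : 'I_L -> 'I_N -> R)
    (i : 'I_L) (j : 'I_N) : 'cV[R[i]]_M :=
  \col_(m < M) expj (- (m%:R * pi * sin (theta i j))).

Definition los_g (R : realType) (L N M : nat) (theta : 'I_L -> 'I_N -> R)
    (alpha K : 'I_L -> 'I_N -> 'I_L -> R)
    (i : 'I_L) (j : 'I_N) (l : 'I_L) : 'cV[R[i]]_M :=
  (Num.sqrt (alpha i j l) * Num.sqrt (K i j l / (1 + K i j l)))%:C
    *: los_h M theta i j.

(* u^H v *)
Definition herm (R : realType) (M : nat) (u v : 'cV[R[i]]_M) : R[i] :=
  (u ^t* *m v) 0 0.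

(* Interference of user (i, j) with user (l, k), at BS l. *)
Definition los_delta (R : realType) (L N M : nat) (theta : 'I_L -> 'I_N -> R)
    (alpha K : 'I_L -> 'I_N -> 'I_L -> R)
    (i : 'I_L) (j : 'I_N) (l : 'I_L) (k : 'I_N) : R :=
  let gij := los_g M theta alpha K i j l in
  let glk := los_g M theta alpha K l k l in
  cabs (herm glk gij / herm glk glk) ^+ 2.

Definition theta_diff (R : realType) (L N : nat) (theta : 'I_L -> 'I_N -> R)
    (i : 'I_L) (j : 'I_N) (l : 'I_L) (k : 'I_N) : R :=
  pi * (sin (theta i j) - sin (theta l k)).

(* Main.v *)
(* The interference is a normalized geometric sum of ratio e^(-jx), with
   x = theta_diff; telescoping it and using |e^(jy) - 1|^2 = 4 sin^2 (y / 2)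
   for y = -x and y = -Mx gives the quotient of squared sines. *)
Require Import Defs.
From mathcomp Require Import all_boot all_order all_algebra.
From mathcomp Require Import complex.
From mathcomp Require Import all_classical all_reals all_analysis.
From mathcomp Require Import ring lra.

Set Implicit Arguments.
Unset Strict Implicit.
Unset Printing Implicit Defensive.

Import Order.TTheory GRing.Theory Num.Theory.

Local Open Scope ring_scope.

Section ArraySum.
Variable R : realType.
Implicit Types (x y : R) (z : R[i]) (M : nat).

Lemma sqr_normc z :
  cabs z ^+ 2 = complex.Re z ^+ 2 + complex.Im z ^+ 2.
Proof. by case: z => a b; rewrite /= sqr_sqrtr // addr_ge0 ?sqr_ge0. Qed.

Lemma sqr_normc_real x : cabs x%:C%C ^+ 2 = x ^+ 2.
Proof. by rewrite sqr_normc /= expr0n addr0. Qed.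

Lemma sqr_normcM z1 z2 : cabs (z1 * z2) ^+ 2 = cabs z1 ^+ 2 * cabs z2 ^+ 2.
Proof. by rewrite ComplexField.Normc.normcM exprMn. Qed.

Lemma sqr_normcV z : cabs z^-1 ^+ 2 = (cabs z ^+ 2)^-1.
Proof. by rewrite ComplexField.Normc.normcV exprVn. Qed.

Lemma expj0 : expj 0 = 1 :> R[i].
Proof. by rewrite /expj cos0 sin0. Qed.

Lemma expjD x y : expj (x + y) = expj x * expj y.
Proof. by rewrite /expj cosD sinD; simpc; congr (_ +i* _)%C; ring. Qed.

Lemma expjX x n : expj x ^+ n = expj (n%:R * x).
Proof.
elim: n => [|n IH]; first by rewrite expr0 mul0r expj0.
by rewrite exprS IH -expjD -[in RHS]natr1 mulrDl mul1r addrC.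
Qed.

Lemma conj_expj x : Num.conj (expj x) = expj (- x).
Proof. by rewrite /expj cosN sinN. Qed.

(** Expanding the modulus leaves [2 - 2 * cos x], which the double-angle formula turns into a
    square. *)
Lemma sqr_normc_expj_sub1 x : cabs (expj x - 1) ^+ 2 = 4 * sin (x / 2) ^+ 2.
Proof.
rewrite sqr_normc /expj /= oppr0 addr0 sin2cos2.
have -> : cos x = 1 - 2 * sin (x / 2) ^+ 2.
  rewrite [in LHS](_ : x = (x / 2) *+ 2); last by rewrite -mulr_natr; field.
  rewrite cos_mulr2n cos2sin2 -mulr_natr; ring.
ring.
Qed.

(** Up to a unimodular phase this is a Dirichlet kernel; it serves as [Theta]. *)
Definition array_sum M x : R[i] := \sum_(m < M) expj (- (m%:R * x)).

Lemma array_sum0 M : array_sum M 0 = M%:R.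
Proof.
rewrite /array_sum (eq_bigr (fun=> 1)) ?sumr_const ?card_ord// => m _.
by rewrite mulr0 oppr0 expj0.
Qed.

Lemma sqr_normc_array_sum M x : sin (x / 2) != 0 ->
  cabs (array_sum M x) ^+ 2 = sin (M%:R * x / 2) ^+ 2 / sin (x / 2) ^+ 2.
Proof.
move=> s0.
have: cabs (expj (- x) ^+ M - 1) ^+ 2 =
      cabs ((expj (- x) - 1) * array_sum M x) ^+ 2.
  rewrite subrX1; congr (cabs (_ * _) ^+ 2).
  by apply: eq_bigr => m _; rewrite expjX mulrN.
rewrite sqr_normcM expjX !sqr_normc_expj_sub1 mulrN !mulNr !sinN !sqrrN => e.
apply: (canRL (mulfK _)); first by rewrite expf_neq0.
(* Both sides of [e] carry the factor 4 of the half-angle identity. *)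
apply: (@mulfI _ 4); first by rewrite pnatr_eq0.
by rewrite e; ring.
Qed.

(** Here [x / 2] lies strictly between [- pi] and [pi]; sine is positive on the positive half, and
    oddness settles the other. *)
Lemma sin_half_neq0 x : - (2 * pi) < x < 2 * pi -> x != 0 -> sin (x / 2) != 0.
Proof.
have pos y : 0 < y < 2 * pi -> 0 < sin (y / 2).
  by move=> /andP[y0 y2]; apply: sin_gt0_pi; apply/andP; split; lra.
move=> /andP[xl xu]; rewrite neq_lt => /orP[x0|x0].
  rewrite -oppr_eq0 -sinN -mulNr gt_eqF// pos//.
  by apply/andP; split; lra.
by rewrite gt_eqF// pos// x0.
Qed.

(** Conjugation fixes the real scalar [a], so both amplitudes factor out unchanged. *)
Lemma hermZ M (a b : R) (u v : 'cV[R[i]]_M) :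
  herm (a%:C%C *: u) (b%:C%C *: v) = (a * b)%:C%C * herm u v.
Proof.
rewrite /herm !mxE mulr_sumr; apply: eq_bigr => m _; rewrite !mxE.
have -> : Num.conj (a%:C%C * u m 0) = a%:C%C * Num.conj (u m 0).
  by rewrite rmorphM; congr (_ * _); exact: conjc_real.
by rewrite rmorphM; ring.
Qed.

(** Conjugation flips the phase of user [(l, k)], so the phases at antenna [m] combine to [-m] times
    [theta_diff]. *)
Lemma herm_los_h (L N M : nat) (theta : 'I_L -> 'I_N -> R)
    (i l : 'I_L) (j k : 'I_N) :
  herm (los_h M theta l k) (los_h M theta i j) =
  array_sum M (theta_diff theta i j l k).
Proof.
rewrite /herm !mxE; apply: eq_bigr => m _.
by rewrite !mxE conj_expj -expjD /theta_diff; congr expj; ring.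
Qed.

End ArraySum.

Theorem theorem1 (R : realType) :
  exists Theta : nat -> R -> R[i],
    (forall (M : nat) (x : R), (1 <= M)%N ->
       (x = 0 -> cabs (Theta M x) ^+ 2 = M%:R ^+ 2) /\
       (- (2 * pi) < x < 2 * pi -> x <> 0 ->
          cabs (Theta M x) ^+ 2 =
            sin (M%:R * x / 2) ^+ 2 / sin (x / 2) ^+ 2)) /\
    (forall (L N M : nat) (theta : 'I_L -> 'I_N -> R)
        (alpha K : 'I_L -> 'I_N -> 'I_L -> R)
        (i l : 'I_L) (j k : 'I_N),
       (1 <= L)%N -> (1 <= N)%N -> (1 <= M)%N ->
       0 < alpha i j l -> 0 < alpha l k l ->
       0 < K i j l -> 0 < K l k l ->
       los_delta M theta alpha K i j l k =
         (alpha i j l * K i j l * (1 + K l k l))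
           / (alpha l k l * K l k l * (1 + K i j l))
         * (cabs (Theta M (theta_diff theta i j l k)) ^+ 2 / M%:R ^+ 2)).
Proof.
exists (@array_sum R); split=> [M x M1|L N M theta alpha K i l j k _ _ M1].
  split=> [->|xb /eqP x0]; last exact/sqr_normc_array_sum/sin_half_neq0.
  by rewrite array_sum0 -(rmorph_nat (real_complex R)) sqr_normc_real.
move=> a1 a2 K1 K2.
have M0 : M%:R != 0 :> R by rewrite pnatr_eq0 -lt0n.
have s2 a c : 0 < a -> 0 < c ->
    (Num.sqrt a * Num.sqrt (c / (1 + c))) ^+ 2 = a * (c / (1 + c)) :> R.
  move=> a0 c0; rewrite exprMn !sqr_sqrtr ?ltW// divr_gt0//.
  by rewrite addr_gt0.
rewrite /los_delta /los_g !hermZ !herm_los_h.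
(* The denominator pairs user [(l, k)] with itself: its array sum is [M], the source of the
   normalization by [M%:R ^+ 2]. *)
have -> : theta_diff theta l k l k = 0 by rewrite /theta_diff subrr mulr0.
rewrite array_sum0 -(rmorph_nat (real_complex R)).
rewrite !(sqr_normcM, sqr_normcV, sqr_normc_real).
move: (s2 _ _ a1 K1) (s2 _ _ a2 K2).
(* Only the squares of the two amplitudes matter: with the amplitudes abstracted, [ei] and [el]
   eliminate the square roots and leave a rational identity for [field]. *)
move: (_ * _) (_ * Num.sqrt (K l k l / _)) => ci cl ei el.
rewrite 2!exprMn ei el.
field.
by rewrite M0 !lt0r_neq0// addr_gt0.
Qed.
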